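(* Let $\lambda\in\overline{K}_c$ with $0<|\lambda|\le q^{-1/q^2}$, and let $p_k\in\overline{K}_c$ ($k\ge1$) and $r_k\in\overline{K}_c$ ($k\ge0$) satisfy $|p_k|\le q^{-1/q^2}$, $|r_k|\le q^{-1/q^2}$ for all $k$. Set $(P(\tau)y)(t)=\sum_{k=1}^\infty p_k\,y^{q^k}(t)$ and $R(t)=\sum_{k=0}^\infty r_kt^{q^k}$. Then the equation $$dy(t)=\lambda\,(y\circ y)(t)+(P(\tau)y)(t)+R(t)$$ possesses solutions of the form $$y(t)=ct^{1/q}+\sum_{n=0}^\infty a_nt^{q^n},\qquad c,a_n\in\overline{K}_c,\ c\ne0,$$ where the series converges on the open unit disk $|t|<1$.
   Context: $q=p^\upsilon$ with $p$ prime, $\upsilon\ge1$. $K=\mathbb F_q((x))$ with absolute value $|\sum_{j\ge N}\xi_jx^j|=q^{-N}$ ($\xi_N\ne0$), so $|x|=q^{-1}$; $\overline{K}_c$ is the completion of an algebraic closure of $K$ with the extended absolute value (it is perfect, so $t^{1/q}$ is well defined). $\tau u=u^q$. The Carlitz derivative is $d=\sqrt[q]{\ }\circ\Delta$ with $(\Delta u)(t)=u(xt)-xu(t)$. $y\circ y$ denotes composition of $y$ with itself. *)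

(* Defs.v *)
From HB Require Import structures.
From mathcomp Require Import all_boot all_order all_algebra.
From mathcomp Require Import all_classical all_reals all_analysis.

Set Implicit Arguments.
Unset Strict Implicit.
Unset Printing Implicit Defensive.

Import Order.TTheory GRing.Theory Num.Theory.
Import numFieldNormedType.Exports.

Local Open Scope classical_set_scope.
Local Open Scope ring_scope.

(* The absolute value is carried as a function [av : C -> R] because the norm
   of a [normedZmodType] satisfies [`|z *+ n| = `|z| *+ n], which is impossible
   in positive characteristic. *)

Record ultrametric_abs (R : realType) (C : fieldType) (av : C -> R) : Prop := {
  av_ge0 : forall z, 0 <= av z;
  av_eq0 : forall z, av z = 0 <-> z = 0;
  avM : forall z w, av (z * w) = av z * av w;
  av_ultra : forall z w, av (z + w) <= Num.max (av z) (av w) }.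

Definition av_cvg (R : realType) (C : fieldType) (av : C -> R)
    (u : nat -> C) (l : C) : Prop :=
  av (u n - l) @[n --> \oo] --> (0 : R).

Definition av_has_sum (R : realType) (C : fieldType) (av : C -> R)
    (u : nat -> C) (l : C) : Prop :=
  av_cvg av (fun n => \sum_(0 <= k < n) u k) l.

Definition av_cauchy (R : realType) (C : fieldType) (av : C -> R)
    (u : nat -> C) : Prop :=
  forall e : R, 0 < e ->
    exists N : nat, forall m n : nat,
      (N <= m)%N -> (N <= n)%N -> av (u m - u n) < e.

Definition av_complete (R : realType) (C : fieldType) (av : C -> R) : Prop :=
  forall u : nat -> C, av_cauchy av u -> exists l : C, av_cvg av u l.

Definition av_dense (R : realType) (C : fieldType) (av : C -> R)
    (A : set C) : Prop :=
  forall (z : C) (e : R), 0 < e -> exists2 w : C, A w & av (z - w) < e.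

(* z = \sum_(j >= N) xi_j x^j, with xi_(N + k) stored as [xi k]. *)
Definition laurent_sum (R : realType) (C : fieldType) (av : C -> R)
    (F : finFieldType) (iota : {rmorphism F -> C}) (x : C)
    (N : int) (xi : nat -> F) (z : C) : Prop :=
  av_has_sum av (fun k => iota (xi k) * x ^ (N + k%:Z)) z.

Definition laurent_field (R : realType) (C : fieldType) (av : C -> R)
    (F : finFieldType) (iota : {rmorphism F -> C}) (x : C) : set C :=
  [set z | exists N xi, laurent_sum av iota x N xi z].

Definition algebraic_over (C : fieldType) (K : set C) : set C :=
  [set z | exists P : {poly C},
     [/\ P != 0, forall i : nat, K P`_i & root P z]].

Definition alg_closed_in (C : fieldType) (L : set C) : Prop :=
  forall P : {poly C}, (1 < size P)%N -> (forall i : nat, L P`_i) ->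
    exists2 z : C, L z & root P z.

(* (C, av) is the completion of an algebraic closure of K = F((x)), for the
   extension of the absolute value of K.  Here K is realized inside C as the set
   of sums of Laurent series: C being complete and |x| = q^-1, every Laurent
   series over F has a sum in C, and [cac_extends] makes F((x)) -> C isometric,
   hence injective.  These conditions determine (C, av) up to isometric
   isomorphism over K. *)
Record completed_alg_closure (R : realType) (C : fieldType) (av : C -> R)
    (F : finFieldType) (iota : {rmorphism F -> C}) (x : C) : Prop := {
  cac_abs : ultrametric_abs av;
  cac_extends : forall (N : int) (xi : nat -> F) (z : C),
    xi 0%N != 0 -> laurent_sum av iota x N xi z -> av z = #|F|%:R ^ (- N);
  cac_closed : alg_closed_in (algebraic_over (laurent_field av iota x));
  cac_dense : av_dense av (algebraic_over (laurent_field av iota x));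
  cac_complete : av_complete av }.

(* For q a power of the characteristic, the q-th root is unique; over a perfect
   field it always exists, so the default value 0 is never used. *)
Definition qroot (C : fieldType) (q : nat) (z : C) : C :=
  xget 0 [set w : C | w ^+ q = z].

Definition carlitz_delta (C : fieldType) (x : C) (u : C -> C) (t : C) : C :=
  u (x * t) - x * u t.

Definition carlitz_d (C : fieldType) (q : nat) (x : C) (u : C -> C) (t : C) : C :=
  qroot q (carlitz_delta x u t).

(* y is given on the open unit disk by c t^(1/q) + \sum_n a_n t^(q^n); its values
   elsewhere are irrelevant. *)
Definition expansion (R : realType) (C : fieldType) (av : C -> R) (q : nat)
    (c : C) (a : nat -> C) (y : C -> C) : Prop :=
  forall t : C, av t < 1 ->
    exists2 s : C, av_has_sum av (fun n => a n * t ^+ (q ^ n)) s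
                 & y t = c * qroot q t + s.

(* y being a function on the open unit disk, y (y t) is defined at the points t
   of the disk with |y t| < 1; the equation is required at all of them, together
   with the convergence of the series P(tau)y and R there.  Only the p_k with
   k >= 1 occur. *)
Definition solves (R : realType) (C : fieldType) (av : C -> R) (q : nat) (x : C)
    (lam : C) (p r : nat -> C) (y : C -> C) : Prop :=
  forall t : C, av t < 1 -> av (y t) < 1 ->
    exists Py Rt : C,
      [/\ av_has_sum av (fun k => p k.+1 * y t ^+ (q ^ k.+1)) Py,
          av_has_sum av (fun k => r k * t ^+ (q ^ k)) Rt
        & carlitz_d q x y t = lam * y (y t) + Py + Rt].

(* Main.v *)
Require Import Defs.
From HB Require Import structures.
From mathcomp Require Import all_boot all_order all_algebra all_field.
From mathcomp Require Import all_classical all_reals all_analysis.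
From mathcomp Require Import ring lra.

Import Order.TTheory GRing.Theory Num.Theory.
Import numFieldNormedType.Exports.

Local Open Scope classical_set_scope.
Local Open Scope ring_scope.

Set Implicit Arguments.
Unset Strict Implicit.

(* Put [u = t^(1/q^2)], [chi = x^(1/q^2)] and look for [y(t) = W(u)^q] with
   [W(u) = \sum_n e_n u^(q^n)], so that [c = e_0^q] and [a_n = e_(n+1)^q].  All
   terms of the equation become Frobenius series in [u]; with
   [g_n = lam e_n^q + p_(n-1)] (the [p] term present for [n >= 2] only),
   comparing coefficients gives
     [e_n (chi^(q^n) - chi^q) = \sum_(i <= n) g_i e_(n-i)^(q^i) + r_(n-2)].
   For [n = 0] this is [lam e_0^q = chi - chi^q]; for [n >= 1] it is a trinomial
   [A w^q + B w + S = 0] for [w = e_n], with [|B| = |chi| = q^(-1/q^2)].  The bound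
   on [lam] gives [D = |e_0| >= 1], and by induction every root has [|e_n| <= D].
   Hence [|W(u)| = D |u|] on the disk: the points with [|y(t)| < 1] are those with
   [D |u| < 1], where the double series of [y (y t)] may be rearranged.

   The completion is not assumed to be algebraically closed: a trinomial is first
   solved approximately, by density of the algebraic elements, and the remaining
   error is corrected by solving [A v^q + B v = s] for small [s]; [w^q] being
   additive, subtracting [v] is enough. *)

(** * Ultrametric absolute values: limits and sums of series *)

Section UltrametricField.
Variables (R : realType) (C : fieldType) (av : C -> R).
Hypothesis hav : ultrametric_abs av.

Lemma av0 : av 0 = 0.
Proof. by apply/(av_eq0 hav). Qed.

Lemma av_eq0P z : (av z == 0) = (z == 0).
Proof. by apply/eqP/eqP => /(av_eq0 hav). Qed.

Lemma av_gt0 z : (0 < av z) = (z != 0).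
Proof. by rewrite lt_neqAle (av_ge0 hav) andbT eq_sym av_eq0P. Qed.

Lemma av1 : av 1 = 1.
Proof.
have h : av 1 != 0 by rewrite av_eq0P oner_eq0.
by apply: (mulfI h); rewrite -(avM hav) !mulr1.
Qed.

Lemma avN z : av (- z) = av z.
Proof.
suff h : av (-1) = 1 by rewrite -mulN1r (avM hav) h mul1r.
apply/eqP; rewrite -(@eqrXn2 _ 2) ?(av_ge0 hav) //.
by rewrite expr1n expr2 -(avM hav) mulrNN mulr1 av1.
Qed.

Lemma avX z n : av (z ^+ n) = av z ^+ n.
Proof. by elim: n => [|n IH]; rewrite ?av1 // !exprS (avM hav) IH. Qed.

Lemma avV z : av z^-1 = (av z)^-1.
Proof.
have [->|z0] := eqVneq z 0; first by rewrite invr0 av0 invr0.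
have h : av z != 0 by rewrite av_eq0P.
by apply: (mulfI h); rewrite -(avM hav) !divff // av1.
Qed.

Lemma avD_le z w M : av z <= M -> av w <= M -> av (z + w) <= M.
Proof. by move=> hz hw; rewrite (le_trans (av_ultra hav z w)) // ge_max hz. Qed.

Lemma avD_lt z w M : av z < M -> av w < M -> av (z + w) < M.
Proof. by move=> hz hw; rewrite (le_lt_trans (av_ultra hav z w)) // gt_max hz. Qed.

Lemma avB_lt z w M : av z < M -> av w < M -> av (z - w) < M.
Proof. by move=> hz hw; apply: avD_lt => //; rewrite avN. Qed.

Lemma avC z w : av (z - w) = av (w - z).
Proof. by rewrite -avN opprB. Qed.

(** A smaller [av (z + w)] would make [z = (z + w) - w] a difference of two elements below
    [av z]. *)
Lemma av_addl z w : av w < av z -> av (z + w) = av z.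
Proof.
move=> h; apply/eqP; rewrite eq_le avD_le ?(ltW h) //=.
rewrite leNgt; apply/negP => h2.
have := avB_lt h2 h.
by rewrite addrK ltxx.
Qed.

Lemma av_sum_le (I : Type) (s : seq I) (P : pred I) (F : I -> C) M :
  0 <= M -> (forall i, P i -> av (F i) <= M) -> av (\sum_(i <- s | P i) F i) <= M.
Proof.
move=> M0 h; elim/big_ind: _ => [|z w|//]; first by rewrite av0.
exact: avD_le.
Qed.

Lemma av_cvgP u l : av_cvg av u l <->
  forall e, 0 < e -> exists N, forall n, (N <= n)%N -> av (u n - l) < e.
Proof.
split=> [h e e0|h].
  have [N _ hN] := (cvgr0Pnorm_lt _).1 h _ e0; exists N => n /hN /=.
  by rewrite ger0_norm ?(av_ge0 hav).
apply/(cvgr0Pnorm_lt (K := R)) => e /h [N hN]; exists N => // n /hN.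
by rewrite /= ger0_norm ?(av_ge0 hav).
Qed.

Lemma av_cvg_uniq u l l' : av_cvg av u l -> av_cvg av u l' -> l = l'.
Proof.
move=> /av_cvgP h /av_cvgP h'; apply/eqP; rewrite -subr_eq0 -av_eq0P eq_le.
rewrite (av_ge0 hav) andbT leNgt; apply/negP => e0.
have [N hN] := h _ e0; have [N' hN'] := h' _ e0.
have := avB_lt (hN' (maxn N N') (leq_maxr _ _)) (hN (maxn N N') (leq_maxl _ _)).
by rewrite opprB addrC addrA subrK ltxx.
Qed.

Lemma av_cvg_le u l M : av_cvg av u l -> (forall n, av (u n) <= M) -> av l <= M.
Proof.
move=> /av_cvgP h hM; rewrite leNgt; apply/negP => Ml.
have M0 : 0 <= M := le_trans (av_ge0 hav _) (hM 0%N).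
have [N hN] := h _ (le_lt_trans M0 Ml).
have : av l <= Num.max (av (l - u N)) (av (u N)).
  by rewrite -{1}[l](subrK (u N)) (av_ultra hav).
rewrite le_max avC leNgt hN //= => /le_lt_trans/(_ (le_lt_trans (hM N) Ml)).
by rewrite ltxx.
Qed.

Lemma av_cvg_dom u v l : av_cvg av u l ->
  (forall e, 0 < e -> exists N, forall n, (N <= n)%N -> av (v n - u n) < e) ->
  av_cvg av v l.
Proof.
move=> /av_cvgP h h'; apply/av_cvgP => e e0.
have [N hN] := h _ e0; have [N' hN'] := h' _ e0.
exists (maxn N N') => n; rewrite geq_max => /andP[/hN h1 /hN' h2].
by have := avD_lt h2 h1; rewrite addrA subrK.
Qed.

Lemma av_has_sum_eq u v l : u =1 v -> av_has_sum av u l -> av_has_sum av v l.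
Proof.
by move=> uv; rewrite /av_has_sum; under eq_fun do under eq_bigr do rewrite uv.
Qed.

Lemma av_has_sumD u v l m : av_has_sum av u l -> av_has_sum av v m ->
  av_has_sum av (fun n => u n + v n) (l + m).
Proof.
move=> /av_cvgP h /av_cvgP h'; apply/av_cvgP => e e0.
have [N hN] := h _ e0; have [N' hN'] := h' _ e0.
exists (maxn N N') => n; rewrite geq_max => /andP[/hN h1 /hN' h2].
by rewrite big_split opprD addrACA avD_lt.
Qed.

Lemma av_has_sumZ c u l : av_has_sum av u l ->
  av_has_sum av (fun n => c * u n) (c * l).
Proof.
move=> /av_cvgP h; apply/av_cvgP => e e0.
have [->|c0] := eqVneq c 0.
  by exists 0%N => n _; rewrite big1 ?mul0r ?subrr ?av0 // => i _; rewrite mul0r.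
have ac : 0 < av c by rewrite av_gt0.
have [N hN] := h _ (divr_gt0 e0 ac); exists N => n /hN.
by rewrite -mulr_sumr -mulrBr (avM hav) ltr_pdivlMr // mulrC.
Qed.

Lemma av_has_sum_shift u l :
  av_has_sum av (fun n => u n.+1) l <-> av_has_sum av u (u 0%N + l).
Proof.
have E n : \sum_(0 <= k < n.+1) u k - (u 0%N + l) = \sum_(0 <= k < n) u k.+1 - l.
  by rewrite big_nat_recl // opprD addrACA subrr add0r.
split=> /(av_cvgP) h; apply/av_cvgP => e /h [N hN].
  by exists N.+1 => -[//|n] /hN; rewrite E.
by exists N => n Nn; rewrite -E hN // leqW.
Qed.

Lemma av_has_sum_le u l M : av_has_sum av u l -> (forall n, av (u n) <= M) ->
  av l <= M.
Proof.
move=> h hM; apply: (av_cvg_le h) => n; apply: av_sum_le => //.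
exact: le_trans (av_ge0 hav _) (hM 0%N).
Qed.

Lemma av_has_sum_tail u l M n : av_has_sum av u l ->
  (forall k, (n <= k)%N -> av (u k) <= M) -> av (l - \sum_(0 <= k < n) u k) <= M.
Proof.
move=> h hM.
apply: (@av_has_sum_le (fun k => u (n + k)%N)); last first.
  by move=> k; apply: hM; rewrite leq_addr.
move/av_cvgP: h => h; apply/av_cvgP => e /h [N hN].
exists N => k Nk; have := hN (n + k)%N (leq_trans Nk (leq_addl _ _)).
suff -> : \sum_(0 <= i < n + k) u i =
    \sum_(0 <= i < n) u i + \sum_(0 <= i < k) u (n + i)%N.
  by rewrite opprB addrA [_ + \sum_(_ <= _ < n) _]addrC.
rewrite (@big_cat_nat _ _ _ n) ?leq_addr //= -{2}[n]add0n big_addn addKn.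
by congr (_ + _); apply: eq_bigr => i _; rewrite addnC.
Qed.

Hypothesis hC : av_complete av.

(** Terms tending to 0 already make the partial sums Cauchy: a block of terms is no larger than its
    largest member. *)
Lemma av_summable u :
  (forall e, 0 < e -> exists N, forall n, (N <= n)%N -> av (u n) < e) ->
  exists l, av_has_sum av u l.
Proof.
move=> h; apply: hC => e e0.
have [N hN] := h _ (divr_gt0 e0 (ltr0n R 2)).
suff H m n : (N <= m)%N -> (m <= n)%N ->
    av (\sum_(0 <= k < n) u k - \sum_(0 <= k < m) u k) < e.
  exists N => m n Nm Nn; have [mn|/ltnW nm] := leqP m n; last exact: H.
  by rewrite avC H.
move=> Nm mn; rewrite (@big_cat_nat _ _ _ m) //= addrAC subrr add0r.
apply: (@le_lt_trans _ _ (e / 2)); last by rewrite gtr_pMr // invf_lt1 // ltr1n.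
rewrite big_nat; apply: av_sum_le => [|k /andP[mk _]]; first by rewrite divr_ge0 // ltW.
exact/ltW/hN/(leq_trans Nm).
Qed.

End UltrametricField.

Lemma expr_small (R : realType) (z e : R) : 0 <= z -> z < 1 -> 0 < e ->
  exists N, forall n, (N <= n)%N -> z ^+ n < e.
Proof.
move=> z0 z1 e0; have hz : `|z| < 1 by rewrite ger0_norm.
have [N _ hN] := (cvgr0Pnorm_lt _).1 (cvg_expr hz) _ e0; exists N => n /hN /=.
by rewrite ger0_norm // exprn_ge0.
Qed.

(** * Roots of [A w^q + B w + S] in the completion *)

Section TrinomialRoots.
Variables (R : realType) (C : fieldType) (av : C -> R) (L : set C) (q : nat).
Hypotheses (hav : ultrametric_abs av) (hL0 : L 0) (hLd : av_dense av L).
Hypotheses (hLc : alg_closed_in L) (q_gt1 : (1 < q)%N).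

Lemma trinomial_root_in A B S : A != 0 -> L A -> L B -> L S ->
  exists w, A * w ^+ q + B * w + S = 0.
Proof.
move=> A0 LA LB LS; pose P := A *: 'X^q + B *: 'X + S%:P.
have coP i : P`_i = A * (i == q)%:R + B * (i == 1%N)%:R + (if i == 0%N then S else 0).
  by rewrite !coefE.
have [||w _] := hLc (P := P).
- rewrite ltnNge; apply/negP => /leq_sizeP/(_ q (ltnW q_gt1)).
  rewrite coP eqxx gtn_eqF // gtn_eqF ?(ltnW q_gt1) // mulr1 mulr0 !addr0.
  by apply/eqP.
- move=> i; rewrite coP; case: eqP => [->|_].
    by rewrite gtn_eqF // gtn_eqF ?(ltnW q_gt1) // mulr1 mulr0 !addr0.
  case: eqP => [->|_] /=; first by rewrite mulr0 mulr1 add0r addr0.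
  by rewrite !mulr0 !add0r; case: ifP.
- by rewrite /root !hornerE => /eqP; exists w.
Qed.

(** The coefficients are replaced by nearby elements of [L], for which an exact root [w] exists.
    Since [w] obeys a bound [M] independent of the approximation, the error is at most its precision
    times [M ^+ q]. *)
Lemma trinomial_root_approx A B S e : A != 0 -> 0 < e ->
  exists w, av (A * w ^+ q + B * w + S) < e.
Proof.
move=> A0 e0; have aA : 0 < av A by rewrite av_gt0.
(* A root with [|w| > M >= 1] would satisfy [|A| |w|^q <= K |w|], hence [|w| <= K / |A| <= M]. *)
pose K := Num.max 1 (Num.max (av B) (av S)); pose M := Num.max 1 (K / av A).
have K1 : 1 <= K by rewrite le_max lexx.
have M1 : 1 <= M by rewrite le_max lexx.
have M0 : 0 < M := lt_le_trans ltr01 M1.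
(* The entry [av A] preserves the size of the leading coefficient, 1 keeps the other two below [K],
   and the last one makes the error less than [e]. *)
pose d := Num.min (av A) (Num.min 1 (e / M ^+ q)).
have d0 : 0 < d by rewrite !lt_min aA ltr01 divr_gt0 ?exprn_gt0.
have dA : d <= av A by rewrite ge_min lexx.
have dK : d <= K by apply: le_trans K1; rewrite !ge_min lexx orbT.
have dM : d * M ^+ q <= e.
  by rewrite -ler_pdivlMr ?exprn_gt0 // /d !ge_min lexx !orbT.
have [A' LA hA] := hLd A d0; have [B' LB hB] := hLd B d0.
have [S' LS hS] := hLd S d0.
have avA' : av A' = av A.
  rewrite -[A'](subrK A) addrC (av_addl hav) // (avC hav).
  exact: lt_le_trans hA dA.
have avB' : av B' <= K.
  rewrite -[B'](subrK B); apply: (avD_le hav); last by rewrite !le_max lexx !orbT.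
  by rewrite (avC hav); apply: le_trans (ltW hB) dK.
have avS' : av S' <= K.
  rewrite -[S'](subrK S); apply: (avD_le hav); last by rewrite !le_max lexx !orbT.
  by rewrite (avC hav); apply: le_trans (ltW hS) dK.
have A'0 : A' != 0 by rewrite -(av_gt0 hav) avA'.
have [w hw] := trinomial_root_in A'0 LA LB LS.
have wM : av w <= M.
  rewrite leNgt; apply/negP => Mw.
  have w1 : 1 < av w := le_lt_trans M1 Mw.
  have : av (A' * w ^+ q) <= K * av w.
    have -> : A' * w ^+ q = - (B' * w + S').
      by apply/eqP; rewrite -subr_eq0 opprK addrA hw.
    rewrite (avN hav); apply: (avD_le hav).
      by rewrite (avM hav) ler_wpM2r // (av_ge0 hav).
    by rewrite (le_trans avS') // ler_peMr ?ltW // (lt_le_trans ltr01).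
  rewrite (avM hav) (avX hav) avA' -(prednK (ltnW q_gt1)) exprSr mulrA.
  rewrite ler_pM2r ?(lt_trans ltr01) // => hK.
  have : av w <= K / av A.
    rewrite ler_pdivlMr // mulrC (le_trans _ hK) // ler_pM2l //.
    by rewrite ler_eXnr // ?ltW // -ltnS prednK // ltnW.
  by rewrite leNgt (le_lt_trans _ Mw) // le_max lexx orbT.
exists w.
have -> : A * w ^+ q + B * w + S =
    (A - A') * w ^+ q + (B - B') * w + (S - S') + (A' * w ^+ q + B' * w + S').
  by ring.
have small z n : (n <= q)%N -> av z < d -> av (z * w ^+ n) < e.
  move=> nq zd; apply: lt_le_trans dM; rewrite (avM hav) (avX hav).
  apply: (@le_lt_trans _ _ (av z * M ^+ q)); last by rewrite ltr_pM2r ?exprn_gt0.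
  rewrite ler_wpM2l ?(av_ge0 hav) //.
  apply: (@le_trans _ _ (M ^+ n)); last by rewrite ler_weXn2l.
  by rewrite lerXn2r // ?nnegrE ?(av_ge0 hav) // ltW.
rewrite hw addr0; apply: (avD_lt hav); last first.
  by have := small _ 0%N (leq0n _) hS; rewrite mulr1.
apply: (avD_lt hav); first exact: small.
exact: small _ 1%N (ltnW q_gt1) hB.
Qed.

Hypotheses (hC : av_complete av) (hq : [pchar C].-nat q).

Lemma exprB_frob (z w : C) : (z - w) ^+ q = z ^+ q - w ^+ q.
Proof. by rewrite exprDn_pchar // exprNn_pchar. Qed.

(** Approximate roots [u k] form a Cauchy sequence, because additivity of Frobenius gives
    [|u m - u n|^q = |u m ^+ q - u n ^+ q|]. *)
Lemma root_exists s : exists z : C, z ^+ q = s.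
Proof.
have h (k : nat) : exists w, av (w ^+ q - s) < 2^-1 ^+ k.
  have k0 : 0 < 2^-1 ^+ k :> R by rewrite exprn_gt0 ?invr_gt0.
  have [w] := trinomial_root_approx 0 (- s) (oner_neq0 C) k0.
  by rewrite mul1r mul0r addr0; exists w.
have [u hu] := choice h.
have half0 : 0 <= 2^-1 :> R by rewrite invr_ge0.
have half1 : 2^-1 < 1 :> R by rewrite invf_lt1 // ltr1n.
have q0 : (0 < q)%N := ltnW q_gt1.
have [z hz] : exists z, av_cvg av u z.
  apply: hC => e e0; have [N hN] := expr_small half0 half1 (exprn_gt0 q e0).
  exists N => m n Nm Nn.
  rewrite -(ltr_pXn2r q0) ?nnegrE ?(av_ge0 hav) ?(ltW e0) // -(avX hav) exprB_frob.
  have -> : u m ^+ q - u n ^+ q = (u m ^+ q - s) - (u n ^+ q - s) by ring.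
  by apply: (avB_lt hav); apply: lt_trans (hu _) (hN _ _).
exists z; apply: (@av_cvg_uniq _ _ _ hav (fun n => u n ^+ q)); last first.
  apply/(av_cvgP hav) => e e0; have [N hN] := expr_small half0 half1 e0.
  by exists N => n /hN; apply: lt_trans (hu n).
apply/(av_cvgP hav) => e e0.
have e1 : 0 < Num.min e 1 by rewrite lt_min e0 ltr01.
have [N hN] := (av_cvgP hav _ _).1 hz _ e1; exists N => n /hN.
rewrite lt_min -exprB_frob (avX hav) => /andP[h1 h2].
by apply: le_lt_trans h1; rewrite ler_iXnr ?(av_ge0 hav) // ltW.
Qed.

(* Near [0] the linear term dominates: the solution is the sum of the series
   [dl 0 + dl 1 + ...] with [B * dl 0 = s] and [B * dl k.+1 = - A * dl k ^+ q],
   whose images telescope since [v ^+ q] is additive. *)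
Lemma binomial_solve_small A B s : B != 0 -> av (s / B) <= 1 ->
  av (A / B) * av (s / B) <= 2^-1 -> exists v, A * v ^+ q + B * v = s.
Proof.
move=> B0 s1 As.
have half0 : 0 <= 2^-1 :> R by rewrite invr_ge0.
have half1 : 2^-1 < 1 :> R by rewrite invf_lt1 // ltr1n.
pose dl := fun k => iter k (fun z => - (A / B) * z ^+ q) (s / B).
have dlS k : dl k.+1 = - (A / B) * dl k ^+ q by [].
have dl_le k : av (dl k) <= av (s / B) * 2^-1 ^+ k.
  elim: k => [|k IH]; first by rewrite mulr1.
  rewrite dlS (avM hav) (avN hav) (avX hav).
  have le1 : av (dl k) <= 1.
    by rewrite (le_trans IH) // mulr_ile1 ?(av_ge0 hav) ?exprn_ge0 ?exprn_ile1 // ltW.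
  (* One of the two factors [av (dl k)] is at most [av (s / B)]; together with [av (A / B)] it gives
     the ratio 1/2 by [As]. *)
  have : av (dl k) ^+ q <= av (dl k) ^+ 2 by rewrite ler_wiXn2l ?(av_ge0 hav).
  move=> /(ler_wpM2l (av_ge0 hav (A / B))) /le_trans; apply.
  rewrite expr2 mulrA exprS mulrCA ler_pM ?mulr_ge0 ?(av_ge0 hav) //.
  apply: le_trans As; rewrite ler_wpM2l ?(av_ge0 hav) // (le_trans IH) //.
  by rewrite ler_piMr ?(av_ge0 hav) // exprn_ile1 // ltW.
have small e : 0 < e -> exists N, forall n, (N <= n)%N -> av (dl n) < e.
  move=> e0; have [N hN] := expr_small half0 half1 e0; exists N => n /hN.
  by apply: le_lt_trans; rewrite (le_trans (dl_le n)) // ler_piMl // exprn_ge0.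
have [v hv] := av_summable hav hC small.
pose V n := \sum_(0 <= k < n) dl k.
have telesc n : A * V n ^+ q + B * V n = s - B * dl n.
  elim: n => [|n IH].
    by rewrite /V big_nil expr0n gtn_eqF ?(ltnW q_gt1) // /dl /=; field.
  rewrite /V big_nat_recr // -/(V n) exprDn_pchar // dlS.
  have -> : A * (V n ^+ q + dl n ^+ q) + B * (V n + dl n) =
    (A * V n ^+ q + B * V n) + (A * dl n ^+ q + B * dl n) by ring.
  by rewrite IH; field.
exists v; pose f z := A * z ^+ q + B * z.
apply: (@av_cvg_uniq _ _ _ hav (fun n => f (V n))); last first.
  apply/(av_cvgP hav) => e e0; have aB : 0 < av B by rewrite av_gt0.
  have [N hN] := small _ (divr_gt0 e0 aB); exists N => n /hN.
  by rewrite /f telesc addrAC subrr add0r (avN hav) (avM hav) ltr_pdivlMr // mulrC.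
apply/(av_cvgP hav) => e e0.
pose K := 1 + av A + av B.
have K0 : 0 < K by rewrite /K -addrA ltr_pwDl // addr_ge0 ?(av_ge0 hav).
pose d := Num.min (e / K) 1.
have d0 : 0 < d by rewrite lt_min ltr01 divr_gt0.
have [N hN] := (av_cvgP hav _ _).1 hv _ d0; exists N => n /hN.
rewrite -/(V n) lt_min => /andP[h1 h2].
have -> : f (V n) - (A * v ^+ q + B * v) = A * (V n - v) ^+ q + B * (V n - v).
  by rewrite /f exprB_frob; ring.
have hK : K * av (V n - v) < e by rewrite mulrC -ltr_pdivlMr.
apply: (@le_lt_trans _ _ (av A * av (V n - v) + av B * av (V n - v))); last first.
  apply: le_lt_trans hK; rewrite -mulrDl ler_wpM2r ?(av_ge0 hav) //.
  by rewrite /K -addrA lerDr.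
apply: (avD_le hav).
  rewrite (avM hav) (avX hav) ler_wpDr ?mulr_ge0 ?(av_ge0 hav) //.
  rewrite ler_wpM2l ?(av_ge0 hav) // ler_iXnr ?(av_ge0 hav) ?(ltW h2) //.
  exact: ltnW.
by rewrite (avM hav) ler_wpDl ?mulr_ge0 ?(av_ge0 hav).
Qed.

Lemma trinomial_root (A B S : C) : A != 0 -> B != 0 ->
  exists w, A * w ^+ q + B * w + S = 0.
Proof.
move=> A0 B0; pose a := av (A / B).
have a0 : 0 <= a := av_ge0 hav _.
(* Chosen so that [d <= 1] and [a * d <= 1/2], the two smallness conditions of
   [binomial_solve_small] for the error [s]. *)
pose d := (2 * (a + 1))^-1.
have a2 : 0 < 2 * (a + 1) by rewrite mulr_gt0 // ltr_wpDl.
have d0 : 0 < d by rewrite invr_gt0.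
have aB : 0 < av B by rewrite av_gt0.
have [w hw] := trinomial_root_approx B S A0 (mulr_gt0 d0 aB).
set s := _ + S in hw.
have sd : av (s / B) <= d by rewrite (avM hav) (avV hav) ler_pdivrMr // ltW.
have d1 : d <= 1 by rewrite invf_le1 //; lra.
have ad : a * d <= 2^-1.
  by rewrite ler_pdivrMr // mulrA mulVf ?pnatr_eq0 // mul1r lerDl.
have [v hv] := binomial_solve_small B0 (le_trans sd d1)
  (le_trans (ler_wpM2l a0 sd) ad).
exists (w - v); rewrite exprB_frob.
have -> : A * (w ^+ q - v ^+ q) + B * (w - v) + S =
  (A * w ^+ q + B * w + S) - (A * v ^+ q + B * v) by ring.
by rewrite hv subrr.
Qed.

End TrinomialRoots.

(** * Series in the powers [u ^+ (q ^ n)] and their composition *)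

Section FrobeniusSeries.
Variables (R : realType) (C : fieldType) (av : C -> R) (q : nat).
Hypotheses (hav : ultrametric_abs av) (hC : av_complete av).
Hypotheses (q_gt1 : (1 < q)%N) (hq : [pchar C].-nat q).

Lemma expr_frobB n (z w : C) : (z - w) ^+ (q ^ n) = z ^+ (q ^ n) - w ^+ (q ^ n).
Proof. by apply: exprB_frob; rewrite pnatX hq. Qed.

Lemma expr_frob_sum n (I : Type) (s : seq I) (P : pred I) (f : I -> C) :
  (\sum_(i <- s | P i) f i) ^+ (q ^ n) = \sum_(i <- s | P i) f i ^+ (q ^ n).
Proof.
apply: (big_morph (fun z => z ^+ (q ^ n))) => [z w|].
  by rewrite exprDn_pchar // pnatX hq.
by rewrite expr0n expn_eq0 gtn_eqF // ltnW.
Qed.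

Lemma av_has_sum_frob (v : nat -> C) l : av_has_sum av v l ->
  av_has_sum av (fun n => v n ^+ q) (l ^+ q).
Proof.
move=> h; apply/(av_cvgP hav) => e e0.
(* Below 1, the [q]-th power of the error is no larger than the error. *)
have e1 : 0 < Num.min e 1 by rewrite lt_min e0 ltr01.
have [N hN] := (av_cvgP hav _ _).1 h _ e1; exists N => n /hN.
have -> : \sum_(0 <= k < n) v k ^+ q = (\sum_(0 <= k < n) v k) ^+ q.
  by rewrite -[q in RHS]expn1 expr_frob_sum expn1.
rewrite lt_min -(exprB_frob hq) (avX hav) => /andP[h1 h2].
by apply: le_lt_trans h1; rewrite ler_iXnr ?(av_ge0 hav) ?(ltnW q_gt1) // ltW.
Qed.

Lemma tau_series_summable (b : nat -> C) (M : R) v :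
  (forall n, av (b n) <= M) -> av v < 1 ->
  exists l, av_has_sum av (fun n => b n * v ^+ (q ^ n)) l.
Proof.
move=> hb v1; apply: (av_summable hav hC) => e e0.
have v0 := av_ge0 hav v.
have M0 : 0 <= M := le_trans (av_ge0 hav _) (hb 0%N).
have M1 : 0 < M + 1 by rewrite ltr_wpDl.
have [N hN] := expr_small v0 v1 (divr_gt0 e0 M1); exists N => n /hN.
rewrite ltr_pdivlMr // mulrC; apply: le_lt_trans.
rewrite (avM hav) (avX hav) ler_pM ?exprn_ge0 ?(av_ge0 hav) //.
  by rewrite (le_trans (hb n)) // lerDl.
by rewrite ler_wiXn2l // ?ltW // ltnW // ltn_expl.
Qed.

(** Passing from [N] to [N.+1], the new diagonal [i + j = N] lengthens every row by one term and
    opens row [N]. *)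
Lemma big_triangle (G : nat -> nat -> C) N :
  \sum_(0 <= n < N) \sum_(i < n.+1) G i (n - i)%N =
  \sum_(0 <= i < N) \sum_(0 <= j < N - i) G i j.
Proof.
elim: N => [|N IH]; first by rewrite !big_nil.
rewrite big_nat_recr // {}IH /= [RHS]big_nat_recr //= subSnn big_nat1.
rewrite -(big_mkord xpredT (fun i => G i (N - i)%N)) big_nat_recr //= subnn addrA.
congr (_ + _); rewrite -big_split; apply: eq_big_nat => i /andP[_ iN] /=.
by rewrite subSn ?big_nat_recr // ltnW.
Qed.

(* Cutting the double series along the triangle [i + j < N] leaves the errors
   [g i * (w - \sum_(j < N - i) e j * u ^+ (q ^ j)) ^+ (q ^ i)], all bounded by
   [mu * (D * av u) ^+ (q ^ N)]. *)
Lemma tau_series_comp (e g : nat -> C) (D mu : R) u w l :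
  1 <= D -> (forall n, av (e n) <= D) -> (forall n, av (g n) <= mu) ->
  D * av u < 1 -> av_has_sum av (fun n => e n * u ^+ (q ^ n)) w ->
  av_has_sum av (fun n => g n * w ^+ (q ^ n)) l ->
  av_has_sum av
    (fun n => (\sum_(i < n.+1) g i * e (n - i)%N ^+ (q ^ i)) * u ^+ (q ^ n)) l.
Proof.
move=> D1 he hg Du hw hl.
have D0 : 0 <= D := le_trans ler01 D1.
have u0 := av_ge0 hav u.
have u1 : av u <= 1 by apply: le_trans (ltW Du); rewrite ler_peMl.
have mu0 : 0 <= mu := le_trans (av_ge0 hav _) (hg 0%N).
have th0 : 0 <= D * av u by rewrite mulr_ge0.
have main N : av (\sum_(0 <= n < N)
      (\sum_(i < n.+1) g i * e (n - i)%N ^+ (q ^ i)) * u ^+ (q ^ n) -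
    \sum_(0 <= n < N) g n * w ^+ (q ^ n)) <= mu * (D * av u) ^+ (q ^ N).
  pose G i j := g i * (e j * u ^+ (q ^ j)) ^+ (q ^ i).
  have -> : \sum_(0 <= n < N)
      (\sum_(i < n.+1) g i * e (n - i)%N ^+ (q ^ i)) * u ^+ (q ^ n) =
      \sum_(0 <= n < N) \sum_(i < n.+1) G i (n - i)%N.
    apply: eq_bigr => n _; rewrite mulr_suml; apply: eq_bigr => i _.
    by rewrite /G exprMn -exprM -expnD subnK ?mulrA // -ltnS.
  rewrite big_triangle -sumrB big_nat.
  apply: (av_sum_le hav) => [|i /andP[_ iN]]; first by rewrite mulr_ge0 // exprn_ge0.
  rewrite -mulr_sumr -expr_frob_sum -mulrBr -expr_frobB (avM hav) (avX hav).
  rewrite ler_pM ?(av_ge0 hav) ?exprn_ge0 ?(av_ge0 hav) // (avC hav).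
  have : av (w - \sum_(0 <= j < N - i) e j * u ^+ (q ^ j)) <= D * av u ^+ (q ^ (N - i)).
    apply: (av_has_sum_tail hav hw) => k Nk.
    rewrite (avM hav) (avX hav) ler_pM ?(av_ge0 hav) ?exprn_ge0 //.
    by rewrite ler_wiXn2l // leq_exp2l.
  (* The power [q ^ i] turns the tail exponent [q ^ (N - i)] of row [i] into [q ^ N], the same for
     all rows; [D >= 1] allows raising the exponent of [D] to [q ^ N] as well. *)
  move=> h; apply: (@le_trans _ _ ((D * av u ^+ (q ^ (N - i))) ^+ (q ^ i))).
    by rewrite lerXn2r // nnegrE ?(av_ge0 hav) // mulr_ge0 // exprn_ge0.
  rewrite !exprMn -exprM -expnD subnK ?(ltnW iN) // ler_wpM2r ?exprn_ge0 //.
  by rewrite ler_weXn2l // leq_exp2l // ltnW.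
apply: (av_cvg_dom hav hl) => eps eps0.
have mu1 : 0 < mu + 1 by rewrite ltr_wpDl.
have [N hN] := expr_small th0 Du (divr_gt0 eps0 mu1); exists N => n /hN.
rewrite ltr_pdivlMr // mulrC; apply: le_lt_trans.
apply: le_trans (main n) _; rewrite ler_pM ?exprn_ge0 ?lerDl //.
by rewrite ler_wiXn2l // ?ltW // ltnW // ltn_expl.
Qed.

End FrobeniusSeries.

(** Each value may depend on all earlier ones: [hist n] records the values below [n], and [hloc]
    lets the final function replace it. *)
Lemma course_of_values_choice (T : Type) (t0 : T) (P : nat -> (nat -> T) -> T -> Prop) :
  (forall n f, exists w, P n f w) ->
  (forall n f g w, (forall i, (i < n)%N -> f i = g i) -> P n f w -> P n g w) ->
  exists f, forall n, P n f (f n).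
Proof.
move=> hex hloc.
have [s hs] := choice (fun nf : nat * (nat -> T) => hex nf.1 nf.2).
pose hist := fix hist n : nat -> T := if n is m.+1 then
  fun i => if (i < m)%N then hist m i else s (m, hist m) else fun=> t0.
exists (fun n => s (n, hist n)) => n.
apply: (hloc _ (hist n)); last exact: hs (n, hist n).
elim: n => // n IH i; rewrite ltnS leq_eqVlt => /orP[/eqP ->|iN] /=.
  by rewrite ltnn.
by rewrite iN IH.
Qed.

(** * Construction of the coefficients and of the solution *)

Section Solution.
Variables (R : realType) (C : fieldType) (av : C -> R) (q : nat).
Hypotheses (hav : ultrametric_abs av) (hC : av_complete av).
Hypotheses (q_gt1 : (1 < q)%N) (hq : [pchar C].-nat q).
Hypothesis perfect : forall s : C, exists z, z ^+ q = s.
Hypothesis trinomial : forall A B S : C, A != 0 -> B != 0 ->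
  exists w, A * w ^+ q + B * w + S = 0.

Lemma qrootK (z : C) : qroot q z ^+ q = z.
Proof. exact: (xgetPex 0 (perfect z)). Qed.

Lemma qroot_expr (z : C) : qroot q (z ^+ q) = z.
Proof.
have /eqP : (qroot q (z ^+ q) - z) ^+ q = 0 by rewrite (exprB_frob hq) qrootK subrr.
by rewrite expf_eq0 (ltnW q_gt1) subr_eq0 => /eqP.
Qed.

Variables (chi lam : C) (pp rr : nat -> C).
Local Notation mu := (av chi).
Hypotheses (chi_gt0 : 0 < mu) (chi_lt1 : mu < 1).
Hypotheses (lam_neq0 : lam != 0) (lam_le : av lam <= mu).
Hypotheses (pp0 : pp 0%N = 0) (rr0 : rr 0%N = 0).
Hypotheses (pp_le : forall n, av (pp n) <= mu) (rr_le : forall n, av (rr n) <= mu).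

Lemma av_chiB n : (0 < n)%N -> av (chi - chi ^+ (q ^ n)) = mu.
Proof.
move=> n0; rewrite (av_addl hav) // (avN hav) (avX hav).
have q1 : (1 < q ^ n)%N by rewrite -(expn0 q) ltn_exp2l.
rewrite -(prednK (ltnW q1)) exprS gtr_pMr // exprn_ilt1 ?ltW //.
by rewrite -lt0n -ltnS prednK // ltnW.
Qed.

Variable e0 : C.
Hypothesis he0 : lam * e0 ^+ q = chi - chi ^+ q.
Local Notation D := (av e0).

Lemma lam_e0 : av lam * D ^+ q = mu.
Proof. by rewrite -(avX hav) -(avM hav) he0 -[q]expn1 av_chiB. Qed.

(** [D < 1] would give [|lam| D^q < |lam| <= |chi|], against [lam_e0]. *)
Lemma e0_ge1 : 1 <= D.
Proof.
rewrite leNgt; apply/negP => D1.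
have := lam_e0; apply/eqP; rewrite lt_eqF //; apply: lt_le_trans lam_le.
rewrite gtr_pMr ?av_gt0 // exprn_ilt1 ?(av_ge0 hav) //.
by rewrite -lt0n ltnW.
Qed.

Lemma e0_neq0 : e0 != 0.
Proof. by rewrite -(av_gt0 hav) (lt_le_trans ltr01) ?e0_ge1. Qed.

(** If [|w| > D], the leading term has size [mu D^(q^n - q) |w|^q], which strictly exceeds both the
    linear term [mu |w|] and the bound [mu D^(q^n)] on [T], so the three terms cannot cancel. *)
Lemma trinomial_root_le n w T : (0 < n)%N -> av T <= mu * D ^+ (q ^ n) ->
  lam * e0 ^+ (q ^ n) * w ^+ q + (chi - chi ^+ (q ^ n)) * w + T = 0 -> av w <= D.
Proof.
move=> n0 hT hw; rewrite leNgt; apply/negP => Dw.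
have D1 := e0_ge1; have w1 := le_lt_trans D1 Dw.
have D0 : 0 < D := lt_le_trans ltr01 D1.
have q0 : (0 < q)%N := ltnW q_gt1.
have qqn : (q <= q ^ n)%N by rewrite -{1}(expn1 q) leq_exp2l.
have E : av (lam * e0 ^+ (q ^ n) * w ^+ q) = mu * (D ^+ (q ^ n - q) * av w ^+ q).
  rewrite !(avM hav) !(avX hav) -{1}(subnK qqn) exprD -lam_e0; ring.
have : av (lam * e0 ^+ (q ^ n) * w ^+ q) < mu * (D ^+ (q ^ n - q) * av w ^+ q).
  have -> : lam * e0 ^+ (q ^ n) * w ^+ q = - ((chi - chi ^+ (q ^ n)) * w + T).
    by apply/eqP; rewrite -subr_eq0 opprK addrA hw.
  rewrite (avN hav); apply: (avD_lt hav).
    rewrite (avM hav) av_chiB // ltr_pM2l //.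
    apply: (@lt_le_trans _ _ (av w ^+ q)); last first.
      by rewrite ler_peMl ?exprn_ege1 // exprn_ge0 // (av_ge0 hav).
    by rewrite ltr_eXnr.
  apply: le_lt_trans hT _; rewrite ltr_pM2l // -{1}(subnK qqn) exprD.
  by rewrite ltr_pM2l ?exprn_gt0 // ltrXn2r ?(av_ge0 hav) // -lt0n.
by rewrite E ltxx.
Qed.

(* Comparison of the coefficients of [u ^+ (q ^ n)]: for [n >= 1] the product
   [lam * e0 ^+ q * e n] of the right-hand side cancels the non-dominant part
   [- chi ^+ q * e n] of the left one, and [e n] is any root of a trinomial. *)
Lemma coefficients_exist : exists e : nat -> C,
  [/\ e 0%N = e0, forall n, av (e n) <= D & forall n,
    e n * (chi ^+ (q ^ n) - chi ^+ q) =
    \sum_(i < n.+1) (lam * e i ^+ q + pp i) * e (n - i)%N ^+ (q ^ i) + rr n].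
Proof.
(* The convolution without its end terms: [i = 0] goes into the linear coefficient, while [i = n]
   gives the leading term and the [pp n] term of [T]. *)
pose S n (f : nat -> C) :=
  \sum_(1 <= i < n) (lam * f i ^+ q + pp i) * f (n - i)%N ^+ (q ^ i).
pose T n f := pp n * e0 ^+ (q ^ n) + S n f + rr n.
pose P n f w := if n == 0%N then w = e0 else
  lam * e0 ^+ (q ^ n) * w ^+ q + (chi - chi ^+ (q ^ n)) * w + T n f = 0.
have [||e he] := @course_of_values_choice C 0 P.
- move=> [|n] f; first by exists e0.
  apply: trinomial; first by rewrite mulf_neq0 // expf_neq0 // e0_neq0.
  by rewrite -(av_gt0 hav) av_chiB.
- move=> [|n] f g w fg //; rewrite /P /= /T => <-.
  congr (_ + (_ + _ + _)); apply: eq_big_nat => i /andP[i1 iN].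
  by rewrite !fg // ltn_subrL i1.
have e_0 : e 0%N = e0 := he 0%N.
have D1 := e0_ge1.
have D0 : 0 <= D := av_ge0 hav _.
have lamX z : av z <= D -> av (lam * z ^+ q) <= mu.
  move=> hz; rewrite -lam_e0 (avM hav) (avX hav) ler_wpM2l ?(av_ge0 hav) //.
  by rewrite lerXn2r // nnegrE (av_ge0 hav).
have e_le n : av (e n) <= D.
  elim/ltn_ind: n => -[_|n IH]; first by rewrite e_0.
  apply: (trinomial_root_le (n := n.+1) _ _ (he n.+1)) => //.
  have muX i : (i <= n.+1)%N -> mu * D ^+ (q ^ i) <= mu * D ^+ (q ^ n.+1).
    by move=> iN; rewrite ler_wpM2l ?(av_ge0 hav) // ler_weXn2l // leq_exp2l.
  apply: (avD_le hav); last first.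
    by rewrite (le_trans (rr_le _)) // ler_peMr ?(av_ge0 hav) // exprn_ege1.
  apply: (avD_le hav).
    by rewrite (avM hav) (avX hav) ler_wpM2r // exprn_ge0.
  rewrite /S big_nat; apply: (av_sum_le hav).
    by rewrite mulr_ge0 ?(av_ge0 hav) // exprn_ge0.
  move=> i /andP[i1 iN]; apply: le_trans (muX i (ltnW iN)).
  rewrite (avM hav) (avX hav) ler_pM ?exprn_ge0 ?(av_ge0 hav) //.
    by apply: (avD_le hav); rewrite ?lamX ?IH.
  by rewrite lerXn2r // ?nnegrE ?(av_ge0 hav) // IH // ltn_subrL i1.
exists e; split=> // -[|n].
  by rewrite big_ord_recl big_ord0 /= pp0 rr0 expn0 !expr1 e_0 he0; ring.
pose G i := (lam * e i ^+ q + pp i) * e (n.+1 - i)%N ^+ (q ^ i).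
have -> : \sum_(i < n.+2) G i = (chi - chi ^+ q) * e n.+1 + S n.+1 e +
    (lam * e n.+1 ^+ q + pp n.+1) * e0 ^+ (q ^ n.+1).
  rewrite -(big_mkord xpredT G) big_ltn // big_nat_recr //= addrA /G subn0 subnn.
  by rewrite e_0 he0 pp0 addr0 expn0 expr1.
have := he n.+1; rewrite /P /= /T => h.
by apply/eqP; rewrite -subr_eq0 -oppr_eq0 -h; apply/eqP; ring.
Qed.

Lemma solution_exists (x : C) (p r : nat -> C) :
  x = (chi ^+ q) ^+ q ->
  (forall k, pp k.+2 = p k.+1) -> (forall k, rr k.+2 = r k) ->
  pp 1%N = 0 -> rr 1%N = 0 ->
  exists (c : C) (a : nat -> C) (y : C -> C),
    [/\ c != 0, expansion av q c a y & solves av q x lam p r y].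
Proof.
move=> xE ppE rrE pp1 rr1.
have [e [e_0 e_le he]] := coefficients_exist.
have q0 : (0 < q)%N := ltnW q_gt1.
pose W u := xget 0 [set w | av_has_sum av (fun n => e n * u ^+ (q ^ n)) w].
have hW u : av u < 1 -> av_has_sum av (fun n => e n * u ^+ (q ^ n)) (W u).
  by move=> u1; have := tau_series_summable hav hC q_gt1 e_le u1; apply: xgetPex.
pose y t := W (qroot q (qroot q t)) ^+ q.
pose a n := e n.+1 ^+ q.
have av_qroot z : av z < 1 -> av (qroot q z) < 1.
  by rewrite -{1}(qrootK z) (avX hav) expr_lt1 ?(av_ge0 hav).
have hy : expansion av q (e0 ^+ q) a y.
  (* Raising the series of [W u] to the power [q] termwise gives that of [y t]; its first term
     [(e0 * u) ^+ q] is the [t^(1/q)] term and is split off. *)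
  move=> t t1; exists (y t - e0 ^+ q * qroot q t); last by rewrite addrC subrK.
  set u := qroot q (qroot q t).
  have tu : t = (u ^+ q) ^+ q by rewrite !qrootK.
  have := av_has_sum_frob hav q_gt1 hq (hW u (av_qroot _ (av_qroot _ t1))).
  rewrite -/(y t) => h.
  have {}h : av_has_sum av (fun n => (e n * u ^+ (q ^ n)) ^+ q)
     ((e 0%N * u ^+ (q ^ 0)) ^+ q + (y t - e0 ^+ q * qroot q t)).
    by rewrite expn0 expr1 e_0 exprMn qrootK addrC subrK.
  have := (av_has_sum_shift hav _ _).2 h; apply: av_has_sum_eq => n /=.
  by rewrite exprMn tu -!exprM /a expnS; congr (_ * _ ^+ _); ring.
exists (e0 ^+ q), a, y; split=> //; first by rewrite expf_neq0 // e0_neq0.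
move=> t t1; set u := qroot q (qroot q t).
have u1 : av u < 1 := av_qroot _ (av_qroot _ t1).
have tu : t = (u ^+ q) ^+ q by rewrite !qrootK.
have ytE : y t = W u ^+ q by [].
set w := W u in ytE; rewrite ytE => yt1.
have w1 : av w < 1 by rewrite -(qroot_expr w) av_qroot.
(* All later terms of [W u] are at most [D |u|^q < |e0 u|], so [|w| = D |u|], and [|w| < 1] is
   known. *)
have Du : D * av u < 1.
  have [->|u0] := eqVneq u 0; first by rewrite (av0 hav) mulr0.
  have au : 0 < av u by rewrite av_gt0.
  have tail : av (w - e0 * u) <= D * av u ^+ q.
    have := @av_has_sum_tail _ _ _ hav _ _ (D * av u ^+ q) 1 (hW u u1).
    rewrite big_nat1 e_0 expn0 expr1; apply => k k1.
    rewrite (avM hav) (avX hav) ler_pM ?(av_ge0 hav) ?exprn_ge0 ?(av_ge0 hav) //.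
    by rewrite ler_wiXn2l ?(av_ge0 hav) ?(ltW u1) // -{1}(expn1 q) leq_exp2l.
  have lead : av (w - e0 * u) < av (e0 * u).
    apply: le_lt_trans tail _; rewrite (avM hav) ltr_pM2l ?av_gt0 ?e0_neq0 //.
    rewrite -(prednK q0) exprS gtr_pMr // exprn_ilt1 ?(av_ge0 hav) //.
    by rewrite -lt0n -ltnS prednK.
  by rewrite -(avM hav) -(av_addl hav lead) addrC subrK.
have [s hs yyE] := hy _ yt1.
have pe k : av (p k.+1) <= mu by rewrite -ppE.
have re k : av (r k) <= mu by rewrite -rrE.
have [Py hPy] : exists l, av_has_sum av (fun k => p k.+1 * (w ^+ q) ^+ (q ^ k.+1)) l.
  have wqq1 : av ((w ^+ q) ^+ q) < 1 by rewrite (avX hav) expr_lt1 ?(av_ge0 hav).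
  have [l hl] := tau_series_summable hav hC q_gt1 pe wqq1.
  exists l; apply: av_has_sum_eq hl => k /=.
  by rewrite -!exprM expnS mulnA.
have [Rt hRt] := tau_series_summable hav hC q_gt1 re t1.
exists Py, Rt; split=> //.
(* The [q]-th root of [w ^+ q] is [w], so the expansion of [y (y t)] is a Frobenius series in [w]
   with coefficients [e n ^+ q]. *)
have sum_yy : av_has_sum av (fun n => e n ^+ q * w ^+ (q ^ n)) (y (w ^+ q)).
  have -> : y (w ^+ q) = e 0%N ^+ q * w ^+ (q ^ 0) + s.
    by rewrite yyE qroot_expr e_0 expn0 expr1.
  apply/(av_has_sum_shift hav); apply: av_has_sum_eq hs => n /=.
  by rewrite -exprM -expnS.
have sum_P : av_has_sum av (fun n => pp n * w ^+ (q ^ n)) Py.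
  have -> : Py = pp 0%N * w ^+ (q ^ 0) + (pp 1%N * w ^+ (q ^ 1) + Py).
    by rewrite pp0 pp1 !mul0r !add0r.
  do 2!apply/(av_has_sum_shift hav); apply: av_has_sum_eq hPy => n /=.
  by rewrite ppE -exprM -expnS.
have sum_R : av_has_sum av (fun n => rr n * u ^+ (q ^ n)) Rt.
  have -> : Rt = rr 0%N * u ^+ (q ^ 0) + (rr 1%N * u ^+ (q ^ 1) + Rt).
    by rewrite rr0 rr1 !mul0r !add0r.
  do 2!apply/(av_has_sum_shift hav); apply: av_has_sum_eq hRt => n /=.
  by rewrite rrE tu -!exprM !expnS mulnA.
have sum_g : av_has_sum av (fun n => (lam * e n ^+ q + pp n) * w ^+ (q ^ n))
    (lam * y (w ^+ q) + Py).
  apply: av_has_sum_eq (av_has_sumD hav (av_has_sumZ hav lam sum_yy) sum_P) => n /=.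
  by rewrite mulrDl mulrA.
have g_le n : av (lam * e n ^+ q + pp n) <= mu.
  apply: (avD_le hav) => //; rewrite -lam_e0 (avM hav) (avX hav).
  by rewrite ler_wpM2l ?(av_ge0 hav) // lerXn2r ?nnegrE ?(av_ge0 hav).
have sum_rhs := av_has_sumD hav
  (tau_series_comp hav q_gt1 hq e0_ge1 e_le g_le Du (hW u u1) sum_g) sum_R.
have chiu1 : av (chi * u) < 1 by rewrite (avM hav) mulr_ilt1 ?(av_ge0 hav).
have sum_lhs := av_has_sumD hav (hW _ chiu1) (av_has_sumZ hav (- chi ^+ q) (hW u u1)).
(* Both sides are sums of the same series in [u], by the coefficient relation [he]. *)
have <- : W (chi * u) + - chi ^+ q * w = lam * y (w ^+ q) + Py + Rt.
  apply: (av_cvg_uniq hav sum_lhs); apply: av_has_sum_eq sum_rhs => n /=.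
  by rewrite -mulrDl -he exprMn; ring.
(* Since [x] is [chi ^+ q] to the power [q], the Carlitz difference is the [q]-th power of
   [W (chi * u) - chi ^+ q * w]. *)
rewrite /carlitz_d /carlitz_delta -[y t]/(w ^+ q).
have -> : y (x * t) = W (chi * u) ^+ q.
  by rewrite /y xE tu -!exprMn !qroot_expr.
by rewrite xE -exprMn -(exprB_frob hq) qroot_expr mulNr.
Qed.

End Solution.

(** * Absolute value of the uniformizer, and the equation over the completed closure *)

Lemma algebraic_over0 (C : fieldType) (K : set C) (z : C) :
  algebraic_over K z -> algebraic_over K 0.
Proof.
case=> P [P0 PK _]; exists (P * 'X); split.
- by rewrite mulf_neq0 // polyX_eq0.
- move=> [|i]; rewrite coefMX //=.
  (* 0 lies in [K] as the coefficient of [P] just past its degree. *)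
  by rewrite -(nth_default 0 (leqnn (size P))).
- by rewrite /root hornerM hornerX mulr0.
Qed.

Lemma av_uniformizer (R : realType) (F : finFieldType) (C : fieldType)
    (av : C -> R) (iota : {rmorphism F -> C}) (x : C) :
  completed_alg_closure av iota x -> av x = #|F|%:R^-1.
Proof.
move=> hC; have hav := cac_abs hC.
(* The Laurent series of [x] itself, starting at exponent 1. *)
pose xi k : F := if k == 0%N then 1 else 0.
rewrite (cac_extends hC (N := 1) (xi := xi)) ?exprN1 ?oner_neq0 //.
have E : x = iota (xi 0%N) * x ^ (1 + 0%:Z) + 0.
  by rewrite /xi /= rmorph1 mul1r !addr0 expr1z.
rewrite /laurent_sum [X in av_has_sum _ _ X]E.
apply/(av_has_sum_shift hav); apply/(av_cvgP hav) => e e_gt0; exists 0%N => n _.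
by rewrite big1 ?subrr ?(av0 hav) // => k _; rewrite /xi /= rmorph0 mul0r.
Qed.

Theorem theorem2 (R : realType) (ell upsilon q : nat)
    (F : finFieldType) (C : fieldType) (av : C -> R)
    (iota : {rmorphism F -> C}) (x : C)
    (hell : prime ell) (hupsilon : (1 <= upsilon)%N)
    (hq : q = (ell ^ upsilon)%N) (hF : #|F| = q)
    (hC : completed_alg_closure av iota x)
    (lam : C) (p r : nat -> C)
    (hlam0 : 0 < av lam)
    (hlam : av lam <= q%:R `^ (- (q%:R ^+ 2)^-1))
    (hp : forall k : nat, (1 <= k)%N -> av (p k) <= q%:R `^ (- (q%:R ^+ 2)^-1))
    (hr : forall k : nat, av (r k) <= q%:R `^ (- (q%:R ^+ 2)^-1)) :
  exists (c : C) (a : nat -> C) (y : C -> C),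
    [/\ c != 0, expansion av q c a y & solves av q x lam p r y].
Proof.
have hav := cac_abs hC; have hcompl := cac_complete hC.
have q_gt1 : (1 < q)%N.
  by rewrite hq -(expn0 ell) ltn_exp2l // prime_gt1.
have q0 : (0 < q)%N := ltnW q_gt1.
have hchar : [pchar C].-nat q.
  rewrite hq pnatX pnatE // (rmorph_pchar iota) //.
  by apply: (@card_finPcharP F ell upsilon); rewrite ?hF.
have L0 : algebraic_over (laurent_field av iota x) 0.
  by have [z Lz _] := cac_dense hC 0 (@ltr01 R); apply: algebraic_over0 Lz.
have perfect := root_exists hav L0 (cac_dense hC) (cac_closed hC) q_gt1 hcompl hchar.
have trinomial :=
  trinomial_root hav L0 (cac_dense hC) (cac_closed hC) q_gt1 hcompl hchar.
have [xi hxi] := perfect x; have [chi hchi] := perfect xi.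
have xE : x = (chi ^+ q) ^+ q by rewrite hchi hxi.
have qR1 : 1 < q%:R :> R by rewrite ltr1n.
have q2_gt0 : (0 < q ^ 2)%N by rewrite expn_gt0 q0.
have chiX : av chi ^+ (q ^ 2) = q%:R^-1.
  by rewrite -(avX hav) -mulnn exprM -xE (av_uniformizer hC) hF.
(* Both sides are nonnegative with [q^2]-th power [1/q], so the bound in the hypotheses is exactly
   [|chi|]. *)
have muE : q%:R `^ (- (q%:R ^+ 2)^-1) = av chi.
  apply/eqP; rewrite -(eqrXn2 q2_gt0) ?powR_ge0 ?(av_ge0 hav) // chiX.
  rewrite -powR_mulrn ?powR_ge0 // -powRrM natrX mulNr mulVf ?powR_inv1 //.
  by rewrite expf_neq0 // pnatr_eq0 -lt0n.
rewrite {}muE in hlam hp hr.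
have chi_gt0 : 0 < av chi.
  rewrite lt_neqAle (av_ge0 hav) andbT eq_sym; apply/eqP => chi0.
  move: chiX; rewrite chi0 expr0n gtn_eqF //= => /esym/eqP.
  by rewrite invr_eq0 pnatr_eq0 gtn_eqF.
have chi_lt1 : av chi < 1.
  by rewrite -(expr_lt1 q2_gt0) ?(av_ge0 hav) // chiX invf_lt1 // (lt_trans ltr01).
have lam_neq0 : lam != 0 by rewrite -(av_gt0 hav).
have [e0 he0] := perfect ((chi - chi ^+ q) / lam).
(* With [y = w^q] and [t = u^(q^2)], [p_k] becomes the coefficient of [w^(q^(k+1))] with [k >= 1],
   and [r_k] that of [u^(q^(k+2))]; hence both start at index 2. *)
pose pp n := if n is k.+2 then p k.+1 else 0.
pose rr n := if n is k.+2 then r k else 0.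
apply: (@solution_exists _ _ _ _ hav hcompl q_gt1 hchar perfect trinomial
  chi lam pp rr chi_gt0 chi_lt1 lam_neq0 hlam _ _ _ _ e0 _ x p r xE) => //.
- by move=> [|[|n]]; rewrite /pp ?(av0 hav) ?(ltW chi_gt0) // hp.
- by move=> [|[|n]]; rewrite /rr ?(av0 hav) ?(ltW chi_gt0) // hr.
- by rewrite he0 mulrC divfK.
Qed.
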